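(* Let $S$ be a finite set of alternatives with $|S|\ge 3$, let $V=\{1,\dots,N\}$ be a finite set of voters, and let $f:\Pi_S^V\to\Pi_S$ be a social welfare function. Then $f$ satisfies Independence of Irrelevant Alternatives (IIA) and Citizens' Sovereignty (CS) if and only if either $f$ is null, or $f$ is dictatorial with some dictator $i$ and defers over $i$ to some clerical-dictatorial function $g:\Pi_S^{V\setminus\{i\}}\to\Pi_S$.
   Context: $\Pi_S$ denotes the set of complete transitive binary relations (weak preferences) on $S$; for $R\in\Pi_S$ we write $x\le_R y$ for $(x,y)\in R$, and $x<_R y$, $x=_R y$ have the obvious meanings. A configuration is ${\bf R}=(R_1,\dots,R_N)\in\Pi_S^V$. A social welfare function (SWF) is any map $f:\Pi_S^V\to\Pi_S$ (for any finite voter set $V$, possibly empty). IIA: whenever ${\bf P},{\bf Q}\in\Pi_S^V$ agree (for every voter) on the pair $\{x,y\}$, $f({\bf P})$ and $f({\bf Q})$ agree on $\{x,y\}$. CS: for every pair $x,y\in S$ there exist configurations ${\bf P},{\bf Q}$ with $x\le_{f({\bf P})}y$ and $y\le_{f({\bf Q})}x$. $f$ is null if $x=_{f({\bf R})}y$ for all ${\bf R}$ and all $x,y$. $f$ is dictatorial with dictator $i$ if either for all $x,y,{\bf R}$: $x\le_{f({\bf R})}y\Rightarrow x\le_{R_i}y$, or for all $x,y,{\bf R}$: $x\le_{f({\bf R})}y\Rightarrow y\le_{R_i}x$. For ${\bf R}\in\Pi_S^V$, ${\bf R}_{-i}\in\Pi_S^{V\setminus\{i\}}$ is its restriction to voters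 other than $i$. A dictatorial $f$ with dictator $i$ defers to $g:\Pi_S^{V\setminus\{i\}}\to\Pi_S$ over $i$ if for all $x,y\in S$ and ${\bf R}$ with $x=_{R_i}y$: $x\le_{f({\bf R})}y\iff x\le_{g({\bf R}_{-i})}y$. $f$ is clerical with cleric $C\in\Pi_S$ if for all $x,y,{\bf R}$: $x\le_{f({\bf R})}y\Rightarrow x\le_C y$. For $A\subseteq S$, the restriction $f|_A:\Pi_A^V\to\Pi_A$ is defined by: given ${\bf R}\in\Pi_A^V$ pick any ${\bf R}'\in\Pi_S^V$ agreeing with ${\bf R}$ on all pairs in $A$, and set $x\le_{f|_A({\bf R})}y$ iff $x\le_{f({\bf R}')}y$ for $x,y\in A$; $f|_A$ is well defined if this does not depend on the choice of ${\bf R}'$. Clerical-dictatorial (recursive definition): $f:\Pi_S^V\to\Pi_S$ is clerical-dictatorial if it is null, or $|S|\le 2$, or there is a cleric $C\in\Pi_S$ such that (1) $f$ is clerical with cleric $C$, and (2) for every equivalence class $A$ of $C$: (a) $f|_A$ is well defined and is null, dictatorial, or $|A|=2$; (b) if $f|_A$ is dictatorial (with dictator $j$) then it defers over $j$ to a clerical-dictatorial function $\Pi_A^{V\setminus\{j\}}\to\Pi_A$. *)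

(* Defs.v *)
From HB Require Import structures.
From mathcomp Require Import all_boot.

Set Implicit Arguments.
Unset Strict Implicit.
Unset Printing Implicit Defensive.

Section Preferences.
Variable S : finType.

(* Completeness at x = y gives reflexivity. *)
Definition complete (R : {set S * S}) : bool :=
  [forall x, forall y, ((x, y) \in R) || ((y, x) \in R)].

Definition transitive_set (R : {set S * S}) : bool :=
  [forall x, forall y, forall z,
     ((x, y) \in R) && ((y, z) \in R) ==> ((x, z) \in R)].

Record pref := Pref {
  pref_set : {set S * S};
  _ : complete pref_set && transitive_set pref_set }.

HB.instance Definition _ := [isSub for pref_set].
HB.instance Definition _ := [Finite of pref by <:].

Definition wle (R : pref) (x y : S) : bool := (x, y) \in pref_set R.
Definition indiff (R : pref) (x y : S) : bool := wle R x y && wle R y x.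

Lemma rel_pref_subproof (r : rel S) :
  total r -> transitive r ->
  complete [set p | r p.1 p.2] && transitive_set [set p | r p.1 p.2].
Proof.
move=> rT rtr; apply/andP; split.
  by apply/forallP=> x; apply/forallP=> y; rewrite !inE /= rT.
apply/forallP=> x; apply/forallP=> y; apply/forallP=> z; rewrite !inE /=.
by apply/implyP=> /andP[xy yz]; apply: rtr xy yz.
Qed.

Definition rel_pref (r : rel S) (rT : total r) (rtr : transitive r) : pref :=
  Pref (rel_pref_subproof rT rtr).

Lemma rel_prefE r rT rtr x y : wle (@rel_pref r rT rtr) x y = r x y.
Proof. by rewrite /wle inE. Qed.

Lemma wle_total (R : pref) : total (wle R).
Proof.
move=> x y; have /andP[/forallP/(_ x)/forallP/(_ y) xy _] := valP R.
exact: xy.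
Qed.

Lemma wle_trans (R : pref) : transitive (wle R).
Proof.
move=> y x z xy yz; have /andP[_ /forallP/(_ x)/forallP/(_ y)] := valP R.
by move/forallP/(_ z)/implyP; apply; apply/andP.
Qed.

End Preferences.

Definition config (S V : finType) := {ffun V -> pref S}.
Definition swf (S V : finType) := config S V -> pref S.

Section SocialWelfare.
Variables S V : finType.
Implicit Types (f : swf S V) (R P Q : config S V).

Definition agree_on (P Q : pref S) (x y : S) : Prop :=
  wle P x y = wle Q x y /\ wle P y x = wle Q y x.

Definition IIA f : Prop :=
  forall P Q (x y : S),
    (forall v, agree_on (P v) (Q v) x y) -> agree_on (f P) (f Q) x y.

Definition CS f : Prop :=
  forall x y : S, exists P Q, wle (f P) x y /\ wle (f Q) y x.

Definition null f : Prop := forall R (x y : S), indiff (f R) x y.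

Definition dictator f (i : V) : Prop :=
  (forall (x y : S) R, wle (f R) x y -> wle (R i) x y) \/
  (forall (x y : S) R, wle (f R) x y -> wle (R i) y x).

Definition dictatorial f : Prop := exists i, dictator f i.

Definition clerical f (C : pref S) : Prop :=
  forall (x y : S) R, wle (f R) x y -> wle C x y.

Definition drop_voter (i : V) R : config S {v : V | v != i} :=
  [ffun v => R (val v)].

Definition defers f (i : V) (g : swf S {v : V | v != i}) : Prop :=
  forall (x y : S) R,
    indiff (R i) x y -> (wle (f R) x y <-> wle (g (drop_voter i R)) x y).

Definition eq_classes (C : pref S) : {set {set S}} :=
  equivalence_partition (indiff C) [set: S].

Section Restriction.
Variable A : {set S}.

Lemma sub_total (R : pref S) :
  total (fun x y : {x | x \in A} => wle R (val x) (val y)).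
Proof. by move=> x y; apply: wle_total. Qed.

Lemma sub_trans (R : pref S) :
  transitive (fun x y : {x | x \in A} => wle R (val x) (val y)).
Proof. by move=> y x z; apply: wle_trans. Qed.

Definition pref_sub (R : pref S) : pref {x | x \in A} :=
  rel_pref (sub_total R) (@sub_trans R).

Definition extends (R : config {x | x \in A} V) (R' : config S V) : bool :=
  [forall v, forall x, forall y, wle (R v) x y == wle (R' v) (val x) (val y)].

Lemma extends_exists (R : config {x | x \in A} V) : exists R', extends R R'.
Proof.
pose r v (x y : S) := match insub x, insub y with
  | Some x', Some y' => wle (R v) x' y' | _, None => true | _, _ => false end.
have rT v : total (r v).
  by move=> x y; rewrite /r; case: (insub x) (insub y) => [a|] [b|] //; apply: wle_total.
have rtr v : transitive (r v).
  move=> y x z; rewrite /r.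
  by case: (insub x) (insub y) (insub z) => [a|] [b|] [c|] //; apply: wle_trans.
exists [ffun v => rel_pref (rT v) (@rtr v)].
apply/forallP=> v; apply/forallP=> x; apply/forallP=> y.
by rewrite ffunE rel_prefE /r !valK.
Qed.

Definition restr_well_defined f : Prop :=
  forall (R : config {x | x \in A} V) (R1 R2 : config S V),
    extends R R1 -> extends R R2 ->
    forall x y : {x | x \in A},
      wle (f R1) (val x) (val y) = wle (f R2) (val x) (val y).

(* An arbitrary extension is chosen; meaningful under restr_well_defined. *)
Definition restr f : swf {x | x \in A} V :=
  fun R : config {x | x \in A} V => pref_sub (f (xchoose (extends_exists R))).

End Restriction.
End SocialWelfare.

Arguments defers {S V} f i g.
Arguments restr_well_defined {S V} A f.
Arguments restr {S V} A f _.

Inductive clerical_dictatorial (S V : finType) (f : swf S V) : Prop :=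
| CD_null of null f
| CD_small of #|S| <= 2
| CD_cleric (C : pref S) of clerical f C &
    (forall A : {set S}, A \in eq_classes C ->
       restr_well_defined A f
       /\ (null (restr A f) \/ dictatorial (restr A f) \/ #|A| = 2)
       /\ (forall j : V, dictator (restr A f) j ->
             exists g : swf {x | x \in A} {v : V | v != j},
               defers (restr A f) j g /\ clerical_dictatorial g)).

(* Main.v *)
(** An IIA function treats each pair of alternatives separately, so the
    relation "x is socially weakly below y for some configuration" is itself a
    complete transitive relation: a cleric.  On each of its classes the
    function satisfies CS, and Wilson's theorem applies: a non-null IIA
    function with CS on at least three alternatives satisfies the Pareto
    principle or its reverse, hence is dictatorial by Arrow's argument on a
    minimal decisive coalition.  A dictatorial IIA function only depends on
    the other voters wherever the dictator is indifferent, which gives an IIA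
    function with one voter less, and one recurses on the number of voters. *)

Require Import Defs.
From mathcomp Require Import all_boot.
From mathcomp Require Import zify.

Set Implicit Arguments.
Unset Strict Implicit.
Unset Printing Implicit Defensive.

(** * Preferences from utilities, and spreading a property over all pairs *)

Section Preferences.
Variable S : finType.
Implicit Types (R : pref S) (x y z : S) (u : S -> nat).

Lemma wle_refl R x : wle R x x.
Proof. by have := wle_total R x x; rewrite orbb. Qed.

Lemma wleNW R x y : ~~ wle R x y -> wle R y x.
Proof. by have := wle_total R x y; case: (wle R x y). Qed.

Lemma utility_total u : total (fun x y => u x <= u y).
Proof. by move=> x y; apply: leq_total. Qed.

Lemma utility_trans u : transitive (fun x y => u x <= u y).
Proof. by move=> y x z; apply: leq_trans. Qed.

Definition utility_pref u : pref S :=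
  rel_pref (utility_total u) (@utility_trans u).

Lemma utility_prefE u x y : wle (utility_pref u) x y = (u x <= u y).
Proof. exact: rel_prefE. Qed.

Lemma flip_total R : total (fun x y => wle R y x).
Proof. by move=> x y; apply: wle_total. Qed.

Lemma flip_trans R : transitive (fun x y => wle R y x).
Proof. by move=> y x z xy yz; apply: wle_trans yz xy. Qed.

(** Applied to social outcomes, this turns a reversed dictator into an ordinary one, so that Arrow's
    argument is run only once. *)
Definition flip R : pref S := rel_pref (flip_total R) (@flip_trans R).

Lemma flipE R x y : wle (flip R) x y = wle R y x.
Proof. exact: rel_prefE. Qed.

(* The utility of x, in {1, 2, 3}, when y is given utility 2. *)
Definition level R y x : nat := 1 + wle R y x + ~~ wle R x y.

Lemma level_le R x y : (level R y x <= 2) = wle R x y.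
Proof.
rewrite /level; have := wle_total R x y.
by case: (wle R x y); case: (wle R y x).
Qed.

Lemma level_ge R x y : (2 <= level R y x) = wle R y x.
Proof.
rewrite /level; have := wle_total R x y.
by case: (wle R x y); case: (wle R y x).
Qed.

Lemma level_gt0 R x y : 0 < level R y x.
Proof. by []. Qed.

Lemma level_le3 R x y : level R y x <= 3.
Proof. by rewrite /level; case: (wle R x y); case: (wle R y x). Qed.

Lemma exists_third x y : 3 <= #|S| -> exists z, (z != x) && (z != y).
Proof.
move=> S3; have : 0 < #|~: [set x; y]|.
  rewrite -(ltn_add2l #|[set x; y]|) addn0 cardsC cards2.
  by apply: leq_ltn_trans S3; case: (x != y).
by case/card_gt0P=> z; rewrite !inE negb_or => zxy; exists z.
Qed.

(** Endpoints are replaced one at a time: (x, y), (x, b), (a, b). If b = x, the detour (x, y), (x,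
    z), (y, z), (y, x), (a, x) through a third z first reverses the pair. *)
Lemma spread (P : S -> S -> Prop) : 3 <= #|S| ->
  (forall x y z, x != y -> z != x -> z != y -> P x y -> P x z) ->
  (forall x y z, x != y -> z != x -> z != y -> P x y -> P z y) ->
  forall x y, x != y -> P x y -> forall a b, a != b -> P a b.
Proof.
move=> S3 PR PL.
have PR' x y z : x != y -> z != x -> P x y -> P x z.
  by case: (eqVneq z y) => [-> //|zy xy zx]; apply: PR.
have PL' x y z : x != y -> z != y -> P x y -> P z y.
  by case: (eqVneq z x) => [-> //|zx xy zy]; apply: PL.
move=> x y xy Pxy a b ab; have [bx|bx] := eqVneq b x.
  have [z /andP[zx zy]] := exists_third x y S3.
  rewrite {b}bx in ab *.
  apply: (@PL' y) => //; first by rewrite eq_sym.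
  apply: (@PR' y z); rewrite 1?eq_sym // 1?eq_sym //.
  by apply: (@PL' x z); rewrite 1?eq_sym //; apply: (@PR' x y).
by apply: (@PL' x) => //; [rewrite eq_sym | apply: (@PR' x y)].
Qed.

End Preferences.

(** * Configurations on three alternatives *)

Section ThreeAlternatives.
Variables S V : finType.
Variables (x y z : S) (yx : y != x) (zx : z != x) (zy : z != y).
Variables a b c : V -> nat.

(** All further alternatives share the rank of z; IIA makes them irrelevant. In its uses, a pair
    with utilities 2 and [level] copies a given configuration, while 0 and 4 lie strictly outside
    the range of [level]. *)
Definition triple_config : config S V :=
  [ffun v => utility_pref
     (fun s => if s == x then a v else if s == y then b v else c v)].

Lemma triple_configE v :
  [/\ wle (triple_config v) x y = (a v <= b v),
      wle (triple_config v) y x = (b v <= a v) &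
      wle (triple_config v) y z = (b v <= c v)] /\
  [/\ wle (triple_config v) z y = (c v <= b v),
      wle (triple_config v) x z = (a v <= c v) &
      wle (triple_config v) z x = (c v <= a v)].
Proof.
rewrite ffunE !utility_prefE !eqxx.
by rewrite (negbTE yx) (negbTE zx) (negbTE zy).
Qed.

End ThreeAlternatives.

(** * Consequences of IIA: the cleric and the deferred function *)

Section IIATheory.
Variables S V : finType.
Variable f : swf S V.
Hypothesis fI : IIA f.

Lemma IIA_wle (P Q : config S V) (x y : S) :
  (forall v, wle (P v) x y = wle (Q v) x y) ->
  (forall v, wle (P v) y x = wle (Q v) y x) ->
  wle (f P) x y = wle (f Q) x y.
Proof. by move=> h1 h2; case: (fI (P := P) (Q := Q) (x := x) (y := y)). Qed.

Lemma IIA_flip : IIA (fun R => flip (f R)).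
Proof. by move=> P Q x y h; have [h1 h2] := fI h; split; rewrite !flipE. Qed.

Definition below x y : bool := [exists R : config S V, wle (f R) x y].

Lemma below_total : total below.
Proof.
move=> x y; pose R : config S V := [ffun=> utility_pref (fun=> 0)].
by case/orP: (wle_total (f R) x y) => h; apply/orP; [left|right];
  apply/existsP; exists R.
Qed.

Lemma below_trans : transitive below.
Proof.
move=> y x z; have [<- //|yx] := eqVneq y x.
have [<- //|zy] := eqVneq z y.
have [->|zx] := eqVneq z x.
  by move=> _ _; apply/existsP; exists [ffun=> utility_pref (fun=> 0)];
    apply: wle_refl.
move=> /existsP[P Pxy] /existsP[Q Qyz]; apply/existsP.
(* With y fixed at 2, one configuration copies P on {x, y} and Q on {y, z}; the pair {x, z} falls
   out as it may. *)
pose R := triple_config x y (fun v => level (P v) y x) (fun=> 2)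
            (fun v => level (Q v) y z).
have RE := triple_configE yx zx zy (fun v => level (P v) y x) (fun=> 2)
            (fun v => level (Q v) y z).
exists R; apply: (@wle_trans _ _ y).
  rewrite (IIA_wle (Q := P)) // => v; have [[h1 h2 _] _] := RE v.
    by rewrite h1 level_le.
  by rewrite h2 level_ge.
rewrite (IIA_wle (Q := Q)) // => v; have [[_ _ h1] [h2 _ _]] := RE v.
  by rewrite h1 level_ge.
by rewrite h2 level_le.
Qed.

Definition cleric_of : pref S := rel_pref below_total below_trans.

Lemma clerical_cleric_of : clerical f cleric_of.
Proof. by move=> x y R h; rewrite rel_prefE; apply/existsP; exists R. Qed.

(** Making j indifferent everywhere serves all pairs at once: on any pair where j is indifferent in
    R, the padded configuration agrees with R, and IIA transfers the outcome. *)
Definition add_indifferent (j : V) (R : config S {v : V | v != j}) :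
    config S V :=
  [ffun v => if insub v is Some w then R w else utility_pref (fun=> 0)].

Definition deferred (j : V) : swf S {v : V | v != j} :=
  fun R => f (add_indifferent R).

Lemma defers_deferred (j : V) : defers f j (@deferred j).
Proof.
move=> x y R /andP[xy yx]; rewrite /deferred.
suff -> : wle (f R) x y = wle (f (add_indifferent (drop_voter j R))) x y by [].
apply: IIA_wle => v; rewrite ffunE.
  by case: insubP => [w _ <-|/negPn/eqP ->]; rewrite ?ffunE ?utility_prefE.
by case: insubP => [w _ <-|/negPn/eqP ->]; rewrite ?ffunE ?utility_prefE.
Qed.

Lemma IIA_deferred (j : V) : IIA (@deferred j).
Proof.
move=> P Q x y h; apply: fI => v; rewrite /agree_on !ffunE.
by case: insubP => [w _ _|//]; apply: h.
Qed.

Lemma restr_well_defined_IIA (A : {set S}) : restr_well_defined A f.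
Proof.
move=> R R1 R2 e1 e2 x y; apply: IIA_wle => v.
  by rewrite -(eqP (forallP (forallP (forallP e1 v) x) y))
    -(eqP (forallP (forallP (forallP e2 v) x) y)).
by rewrite -(eqP (forallP (forallP (forallP e1 v) y) x))
  -(eqP (forallP (forallP (forallP e2 v) y) x)).
Qed.

End IIATheory.

(** * Restriction to a subset of alternatives *)

Lemma restrE (S V : finType) (f : swf S V) (A : {set S})
    (R : config {x | x \in A} V) (R' : config S V) (x y : {x | x \in A}) :
  restr_well_defined A f -> extends R R' ->
  wle (restr A f R) x y = wle (f R') (val x) (val y).
Proof.
move=> wd e; rewrite rel_prefE; apply: (wd R) => //.
exact: (xchooseP (extends_exists R)).
Qed.

Definition sub_config (S V : finType) (A : {set S}) (R : config S V) :
  config {x | x \in A} V := [ffun v => pref_sub A (R v)].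

Lemma extends_sub_config (S V : finType) (A : {set S}) (R : config S V) :
  extends (sub_config A R) R.
Proof.
by apply/forallP=> v; apply/forallP=> x; apply/forallP=> y;
  rewrite ffunE rel_prefE.
Qed.

Lemma restr_sub_config (S V : finType) (f : swf S V) (A : {set S})
    (R : config S V) (x y : {x | x \in A}) :
  restr_well_defined A f ->
  wle (restr A f (sub_config A R)) x y = wle (f R) (val x) (val y).
Proof. by move=> wd; apply: restrE => //; apply: extends_sub_config. Qed.

Lemma IIA_restr (S V : finType) (f : swf S V) (A : {set S}) :
  IIA f -> IIA (restr A f).
Proof.
move=> fI P Q x y h; rewrite /agree_on !rel_prefE.
apply: fI => v; have [h1 h2] := h v.
have eP := xchooseP (extends_exists P).
have eQ := xchooseP (extends_exists Q).
split.
  by rewrite -(eqP (forallP (forallP (forallP eP v) x) y))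
    -(eqP (forallP (forallP (forallP eQ v) x) y)).
by rewrite -(eqP (forallP (forallP (forallP eP v) y) x))
  -(eqP (forallP (forallP (forallP eQ v) y) x)).
Qed.

(** * Spreading the Pareto principle by CS *)

Section Pareto.
Variables S V : finType.
Hypothesis S3 : 3 <= #|S|.
Variable f : swf S V.
Hypothesis fI : IIA f.

Definition pareto_on (x y : S) : Prop :=
  forall R : config S V, (forall v, ~~ wle (R v) y x) -> ~~ wle (f R) y x.

Definition pareto : Prop := forall x y, x != y -> pareto_on x y.

(** This allows the Pareto principle on a pair to be tested on a single unanimous configuration of
    one's choice. *)
Lemma IIA_unanimous (x y : S) (P Q : config S V) :
  (forall v, ~~ wle (P v) y x) -> (forall v, ~~ wle (Q v) y x) ->
  wle (f P) y x = wle (f Q) y x.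
Proof.
move=> hP hQ; apply: (IIA_wle fI) => v.
  by rewrite (negbTE (hP v)) (negbTE (hQ v)).
by rewrite (wleNW (hP v)) (wleNW (hQ v)).
Qed.

Hypothesis fC : CS f.

Lemma pareto_spread (x y : S) : x != y -> pareto_on x y -> pareto.
Proof.
move=> xy Pxy; apply: (spread S3 _ _ xy Pxy) =>
  {xy Pxy} {}x {}y z xy zx zy Pxy R hR.
  have [Q [_ [Qyz _]]] := fC y z.
  have yx : y != x by rewrite eq_sym.
  (* Everyone puts x at the bottom, and {y, z} copies Q: socially x < y by hypothesis and y <= z by
     CS, hence x < z. *)
  have RE := triple_configE yx zx zy (fun=> 0) (fun=> 2)
    (fun v => level (Q v) y z).
  set T := triple_config _ _ _ _ _ in RE.
  have Txy : ~~ wle (f T) y x.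
    by apply: Pxy => v; have [[_ -> _] _] := RE v.
  have Tyz : wle (f T) y z.
    rewrite (IIA_wle fI (Q := Q)) // => v; have [[_ _ h1] [h2 _ _]] := RE v.
      by rewrite h1 level_ge.
    by rewrite h2 level_le.
  rewrite (IIA_unanimous hR (Q := T)) => [|v].
    by apply: contra Txy => h; apply: wle_trans Tyz h.
  by have [_ [_ _ ->]] := RE v; rewrite -ltnNge level_gt0.
have [Q [_ [Qzx _]]] := fC z x.
have yx : y != x by rewrite eq_sym.
(* Dually, everyone puts y on top and {z, x} copies Q, so that z <= x < y socially. *)
have RE := triple_configE yx zx zy (fun=> 2) (fun=> 4)
  (fun v => level (Q v) x z).
set T := triple_config _ _ _ _ _ in RE.
have Txy : ~~ wle (f T) y x.
  by apply: Pxy => v; have [[_ -> _] _] := RE v.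
have Tzx : wle (f T) z x.
  rewrite (IIA_wle fI (Q := Q)) // => v; have [_ [_ h1 h2]] := RE v.
    by rewrite h2 level_le.
  by rewrite h1 level_ge.
rewrite (IIA_unanimous hR (Q := T)) => [|v].
  by apply: contra Txy => h; apply: wle_trans h Tzx.
by have [[_ _ ->] _] := RE v; rewrite -ltnNge ltnS level_le3.
Qed.

End Pareto.

(** * Arrow's theorem by decisive coalitions *)

Section Arrow.
Variables S V : finType.
Hypothesis S3 : 3 <= #|S|.
Variable f : swf S V.
Hypotheses (fI : IIA f) (fP : pareto f).
Implicit Types (G : {set V}) (R : config S V) (x y z : S).

Definition opposed G x y R : Prop :=
  forall v, if v \in G then ~~ wle (R v) y x else ~~ wle (R v) x y.

Definition weakly_decisive G x y : Prop :=
  forall R, opposed G x y R -> ~~ wle (f R) y x.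

Definition decisive G x y : Prop :=
  forall R, (forall v, v \in G -> ~~ wle (R v) y x) -> ~~ wle (f R) y x.

Lemma decisiveW G x y : decisive G x y -> weakly_decisive G x y.
Proof. by move=> d R o; apply: d => v vG; have := o v; rewrite vG. Qed.

(** Opposition fixes every voter on the pair, so by IIA one opposed configuration settles them
    all. *)
Lemma opposed_weakly_decisive G x y R :
  opposed G x y R -> ~~ wle (f R) y x -> weakly_decisive G x y.
Proof.
move=> oR nR Q oQ; rewrite (IIA_wle fI (Q := R)) // => v;
  have := oR v; have := oQ v; case: (v \in G) => h1 h2;
  by rewrite ?(negbTE h1) ?(negbTE h2) ?(wleNW h1) ?(wleNW h2).
Qed.

(** Insert y: G ranks x < y < z, the others put y below both and rank {x, z} as in R. Weak
    decisiveness gives x < y and Pareto gives y < z. *)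
Lemma weakly_decisive_right G x y z : x != y -> z != x -> z != y ->
  weakly_decisive G x y -> decisive G x z.
Proof.
move=> xy zx zy d R hR; have yx : y != x by rewrite eq_sym.
have RE := triple_configE yx zx zy
  (fun v => if v \in G then 0 else 2)
  (fun v => if v \in G then 1 else 0)
  (fun v => if v \in G then 2 else level (R v) x z).
set T := triple_config _ _ _ _ _ in RE.
have Txy : ~~ wle (f T) y x.
  by apply: d => v; have [[-> -> _] _] := RE v; case: (v \in G).
have Tyz : ~~ wle (f T) z y.
  apply: fP => [|v]; first by rewrite eq_sym.
  by have [_ [-> _ _]] := RE v; case: (v \in G) => //; rewrite -ltnNge level_gt0.
rewrite (IIA_wle fI (Q := T)) => [|v|v].
- by apply: contra Txy => h; apply: wle_trans (wleNW Tyz) h.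
- have [_ [_ _ ->]] := RE v; case: (boolP (v \in G)) => [vG|_]; last by rewrite level_le.
  by rewrite (negbTE (hR _ vG)).
have [_ [_ -> _]] := RE v; case: (boolP (v \in G)) => [vG|_]; last by rewrite level_ge.
by rewrite (wleNW (hR _ vG)).
Qed.

(** Insert x: G ranks z < x < y, the others put x above both and rank {z, y} as in R. Pareto gives z
    < x and weak decisiveness x < y. *)
Lemma weakly_decisive_left G x y z : x != y -> z != x -> z != y ->
  weakly_decisive G x y -> decisive G z y.
Proof.
move=> xy zx zy d R hR; have yx : y != x by rewrite eq_sym.
have RE := triple_configE yx zx zy
  (fun v => if v \in G then 1 else 4)
  (fun=> 2)
  (fun v => if v \in G then 0 else level (R v) y z).
set T := triple_config _ _ _ _ _ in RE.
have Txy : ~~ wle (f T) y x.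
  by apply: d => v; have [[-> -> _] _] := RE v; case: (v \in G).
have Tzx : ~~ wle (f T) x z.
  apply: fP => [|v] //.
  by have [_ [_ -> _]] := RE v; case: (v \in G) => //; rewrite -ltnNge ltnS level_le3.
rewrite (IIA_wle fI (Q := T)) => [|v|v].
- by apply: contra Txy => h; apply: wle_trans h (wleNW Tzx).
- have [[_ _ ->] _] := RE v; case: (boolP (v \in G)) => [vG|_]; last by rewrite level_ge.
  by rewrite (negbTE (hR _ vG)).
have [_ [-> _ _]] := RE v; case: (boolP (v \in G)) => [vG|_]; last by rewrite level_le.
by rewrite (wleNW (hR _ vG)).
Qed.

Lemma decisive_spread G x y : x != y -> weakly_decisive G x y ->
  forall a b, a != b -> decisive G a b.
Proof.
move=> xy d a b ab; have [z /andP[za zb]] := exists_third a b S3.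
(* Weak decisiveness is spread to (a, z); the last step to (a, b) upgrades it to decisiveness. *)
apply: (@weakly_decisive_right G a z b); rewrite 1?eq_sym // 1?eq_sym //.
apply: (spread S3 _ _ xy d); last by rewrite eq_sym.
  by move=> p q r pq rp rq /(weakly_decisive_right pq rp rq)/decisiveW.
by move=> p q r pq rp rq /(weakly_decisive_left pq rp rq)/decisiveW.
Qed.

Definition all_decisive G : Prop := forall a b, a != b -> decisive G a b.

Lemma exists_distinct3 : exists x y z : S, [/\ y != x, z != x & z != y].
Proof.
have /card_gt0P[x _] : 0 < #|S| by apply: leq_trans S3.
have [y /andP[yx _]] := exists_third x x S3.
have [z /andP[zx zy]] := exists_third x y S3.
by exists x, y, z.
Qed.

(** A decisive empty coalition would impose x < y even when all voters rank y < x, against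
    Pareto. *)
Lemma all_decisive_neq0 G : all_decisive G -> G != set0.
Proof.
move=> d; apply/negP=> /eqP G0; have [x [y [_ [yx _ _]]]] := exists_distinct3.
pose R : config S V := [ffun=> utility_pref (fun s => s == x : nat)].
have /negP[] : ~~ wle (f R) y x.
  by apply: d => [|v]; rewrite 1?eq_sym // G0 inE.
apply: wleNW; apply: fP => // v.
by rewrite ffunE utility_prefE eqxx (negbTE yx).
Qed.

(* The Condorcet configuration: i has x < y < z, the rest of G has z < x < y,
   and everybody else has y < z < x. *)
Lemma all_decisive_split G i : i \in G -> all_decisive G ->
  all_decisive [set i] \/ all_decisive (G :\ i).
Proof.
move=> iG d; have [x [y [z [yx zx zy]]]] := exists_distinct3.
have RE := triple_configE yx zx zy
  (fun v => if v == i then 0 else if v \in G then 1 else 2)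
  (fun v => if v == i then 1 else if v \in G then 2 else 0)
  (fun v => if v == i then 2 else if v \in G then 0 else 1).
set T := triple_config _ _ _ _ _ in RE.
have Txy : ~~ wle (f T) y x.
  apply: d => [|v vG]; first by rewrite eq_sym.
  by have [[_ -> _] _] := RE v; rewrite vG; case: (v == i).
(* Exactly [G :\ i] ranks z < y, and exactly i ranks x < z. As x < y socially, z <= x yields z < y
   for the former; otherwise i prevails on (x, z). *)
have [Tzx|Txz] := boolP (wle (f T) z x); [right | left].
  apply: (decisive_spread zy); apply: (opposed_weakly_decisive (R := T)).
    move=> v; have [[_ _ ->] [-> _ _]] := RE v; rewrite !inE.
    by case: (v == i) => //=; case: (v \in G).
  by apply: contra Txy => h; apply: wle_trans h Tzx.
apply: (@decisive_spread _ x z); first by rewrite eq_sym.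
apply: (opposed_weakly_decisive (R := T)) => // v.
by have [_ [_ -> ->]] := RE v; rewrite !inE; case: (v == i) => //; case: (v \in G).
Qed.

(** Voters are split off one by one; since the coalition left over is never empty, some singleton
    must turn out decisive. *)
Lemma exists_decisive_voter G : all_decisive G ->
  exists i, all_decisive [set i].
Proof.
have [n] := ubnP #|G|; elim: n => // n IH in G *; rewrite ltnS => Gn d.
have /set0Pn[i iG] := all_decisive_neq0 d.
have [|d'] := all_decisive_split iG d; first by exists i.
apply: IH d'; move: Gn; rewrite (cardsD1 i) iG; lia.
Qed.

Lemma arrow : exists i, forall x y R, wle (f R) x y -> wle (R i) x y.
Proof.
have [|i d] := @exists_decisive_voter setT.
  by move=> a b ab R hR; apply: fP => // v; apply: hR.
exists i => x y R; apply: contraLR => h.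
apply: d => [|v]; last by rewrite inE => /eqP ->.
by apply: contraNneq h => ->; apply: wle_refl.
Qed.

End Arrow.

(** * Wilson's theorem *)

Lemma null_or_strict (S V : finType) (f : swf S V) :
  null f \/ exists R x y, ~~ wle (f R) y x.
Proof.
have [/existsP[R /existsP[x /existsP[y h]]]|h] :=
  boolP [exists R : config S V, exists x, exists y, ~~ wle (f R) y x].
  by right; exists R, x, y.
left=> R x y.
have all_le a b : wle (f R) a b.
  apply: contraNT h => ab.
  by apply/existsP; exists R; apply/existsP; exists b; apply/existsP; exists a.
by rewrite /indiff !all_le.
Qed.

(* If society ranks x < y for some configuration P and does not reverse the
   unanimous y < z, then it also follows a unanimous x < z. *)
Lemma strict_pareto (S V : finType) (f : swf S V) (P : config S V)
    (x y z : S) : 3 <= #|S| -> IIA f -> CS f ->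
  y != x -> z != x -> z != y -> ~~ wle (f P) y x ->
  (forall R : config S V, (forall v, ~~ wle (R v) z y) -> wle (f R) y z) ->
  pareto f.
Proof.
move=> S3 fI fC yx zx zy Pxy uyz.
apply: (@pareto_spread _ _ S3 _ fI fC x z); first by rewrite eq_sym.
move=> R hR.
have RE := triple_configE yx zx zy (fun v => level (P v) y x) (fun=> 2)
  (fun=> 4).
set T := triple_config _ _ _ _ _ in RE.
have Tyz : wle (f T) y z by apply: uyz => v; have [_ [-> _ _]] := RE v.
have Txy : ~~ wle (f T) y x.
  rewrite (IIA_wle fI (Q := P)) // => v; have [[h1 h2 _] _] := RE v.
    by rewrite h2 level_ge.
  by rewrite h1 level_le.
rewrite (IIA_unanimous fI hR (Q := T)) => [|v].
  by apply: contra Txy => h; apply: wle_trans Tyz h.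
by have [_ [_ _ ->]] := RE v; rewrite -ltnNge ltnS level_le3.
Qed.

Lemma CS_flip (S V : finType) (f : swf S V) :
  CS f -> CS (fun R => flip (f R)).
Proof.
by move=> fC x y; have [P [Q [h1 h2]]] := fC x y; exists Q, P; rewrite !flipE.
Qed.

Theorem wilson (S V : finType) (f : swf S V) :
  3 <= #|S| -> IIA f -> CS f -> null f \/ dictatorial f.
Proof.
move=> S3 fI fC; have [|[P [x [y Pxy]]]] := null_or_strict f; first by left.
right; have yx : y != x.
  by apply: contraNneq Pxy => ->; apply: wle_refl.
have [z /andP[zx zy]] := exists_third x y S3.
(* [U] ranks y < z unanimously and by IIA stands for all such configurations. Either society keeps y
   <= z, and Pareto follows, or it strictly reverses the pair, and the flipped function is Pareto on
   (y, z). *)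
pose U : config S V := [ffun=> utility_pref (fun s => s == z : nat)].
have hU v : ~~ wle (U v) z y.
  by rewrite ffunE utility_prefE eqxx eq_sym (negbTE zy).
have [Uzy|Uzy] := boolP (wle (f U) y z).
  have fP : pareto f.
    apply: (strict_pareto S3 fI fC yx zx zy Pxy) => R hR.
    rewrite (IIA_wle fI (Q := U)) // => v.
      by rewrite (wleNW (hR v)) (wleNW (hU v)).
    by rewrite (negbTE (hR v)) (negbTE (hU v)).
  by have [i di] := arrow S3 fI fP; exists i; left.
have gI := IIA_flip fI; have gC := CS_flip fC.
have gP : pareto (fun R => flip (f R)).
  apply: (@pareto_spread _ _ S3 _ gI gC y z); first by rewrite eq_sym.
  move=> R hR; rewrite (IIA_unanimous gI hR hU) flipE; exact: Uzy.
have [i di] := arrow S3 gI gP; exists i; right=> x' y' R h.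
by apply: di; rewrite flipE.
Qed.

(** * IIA functions are clerical-dictatorial *)

Lemma card_drop_voter (V : finType) (j : V) : #|{: {v : V | v != j}}| < #|V|.
Proof.
rewrite card_sig (eq_card (B := predC1 j)) // cardC1 prednK //.
by apply/card_gt0P; exists j.
Qed.

Lemma eq_class_indiff (S : finType) (C : pref S) (A : {set S}) x y :
  A \in eq_classes C -> x \in A -> y \in A -> wle C x y.
Proof.
case/imsetP=> x0 _ ->; rewrite !inE /= => /andP[_ h1] /andP[h2 _].
exact: wle_trans h1 h2.
Qed.

Lemma IIA_clerical_dictatorial (S V : finType) (f : swf S V) :
  IIA f -> clerical_dictatorial f.
Proof.
(* S is generalized too, since the recursion passes to a class of the cleric. *)
have [n] := ubnP #|V|; elim: n => // n IH in S V f *; rewrite ltnS => Vn fI.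
apply: (CD_cleric (C := cleric_of fI)); first exact: clerical_cleric_of.
move=> A AC; have wd := restr_well_defined_IIA fI (A := A).
have rI : IIA (restr A f) by apply: IIA_restr.
split=> //; split.
  have [A3|A3] := ltnP 2 #|A|.
    have rC : CS (restr A f).
      (* Members of one class are [below] each other; restricting the witnessing configurations to A
         gives CS. *)
      have ex (x y : {x | x \in A}) : exists P, wle (restr A f P) x y.
        have := eq_class_indiff AC (valP x) (valP y).
        rewrite rel_prefE => /existsP[R h].
        by exists (sub_config A R); rewrite restr_sub_config.
      by move=> x y; have [P hP] := ex x y; have [Q hQ] := ex y x; exists P, Q.
    have [||] := wilson _ rI rC; first by rewrite card_sig.
      by left.
    by right; left.
  have [->|A2] := eqVneq #|A| 2; first by right; right.
  have /card_le1P A1 : #|A| <= 1 by lia.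
  left=> R x y; suff -> : x = y by rewrite /indiff wle_refl.
  apply: val_inj; apply/eqP; rewrite eq_sym.
  by rewrite -[_ == _]/(val y \in pred1 (val x)) -(A1 _ (valP x)) (valP y).
move=> j _; exists (deferred (restr A f) (j := j)); split.
  exact: defers_deferred.
by apply: IH; [apply: leq_trans (card_drop_voter j) Vn | apply: IIA_deferred].
Qed.

(** * The converse: IIA and CS from the recursive description *)

Lemma dictator_IIA (S V : finType) (f : swf S V) (i : V)
    (g : swf S {v : V | v != i}) :
  dictator f i -> defers f i g -> IIA g -> IIA f.
Proof.
move=> df fg gI.
suff key (P Q : config S V) x y : (forall v, agree_on (P v) (Q v) x y) ->
    wle (f P) x y -> wle (f Q) x y.
  have sym (P Q : config S V) x y : (forall v, agree_on (P v) (Q v) x y) ->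
      forall v, agree_on (Q v) (P v) x y by move=> h v; have [] := h v.
  have swap (P Q : config S V) x y : (forall v, agree_on (P v) (Q v) x y) ->
      forall v, agree_on (P v) (Q v) y x by move=> h v; have [] := h v.
  move=> P Q x y h; split; apply/idP/idP; apply: key; auto.
move=> h Pxy; have [h1 h2] := h i.
(* Where the dictator is indifferent, g decides; where it is strict, opposite outcomes for P and Q
   would force it to be indifferent. *)
have [ind|nind] := boolP (indiff (Q i) x y).
  apply/(fg _ _ _ ind).
  have [<- _] : agree_on (g (drop_voter i P)) (g (drop_voter i Q)) x y.
    by apply: gI => v; rewrite /agree_on !ffunE; apply: h.
  by apply/fg; rewrite // /indiff h1 h2.
apply: contraNT nind => nQ; have Qyx := wleNW nQ.
rewrite /indiff; case: df => d.
  by rewrite (d _ _ _ Qyx) -h1 (d _ _ _ Pxy).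
by rewrite (d _ _ _ Qyx) -h2 (d _ _ _ Pxy).
Qed.

Lemma null_IIA (S V : finType) (f : swf S V) : null f -> IIA f.
Proof.
by move=> f0 P Q x y _; have /andP[] := f0 P x y; have /andP[] := f0 Q x y;
  split; apply/idP/idP.
Qed.

Lemma pref_eqP (S : finType) (P Q : pref S) :
  (forall x y, wle P x y = wle Q x y) -> P = Q.
Proof. by move=> h; apply: val_inj; apply/setP=> -[x y]; apply: h. Qed.

(** With at most two alternatives, agreement on a pair of distinct ones is equality of
    configurations. *)
Lemma small_IIA (S V : finType) (f : swf S V) : #|S| <= 2 -> IIA f.
Proof.
move=> S2 P Q x y h; have [->|xy] := eqVneq x y.
  by split; rewrite !wle_refl.
have Sxy s : (s == x) || (s == y).
  have : [set x; y] = [set: S].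
    by apply/eqP; rewrite eqEcard subsetT cardsT cards2 xy.
  by move/setP/(_ s); rewrite !inE.
suff -> : P = Q by [].
apply/ffunP=> v; have [h1 h2] := h v; apply: pref_eqP => a b.
by case/orP: (Sxy a) => /eqP ->; case/orP: (Sxy b) => /eqP ->;
  rewrite ?wle_refl.
Qed.

(** A pair on which the cleric is strict has a constant social ranking. Any other pair lies in one
    class, where the restriction is null, lives on two alternatives, or has a dictator and, by
    induction on the number of voters, defers to an IIA function. *)
Lemma clerical_dictatorial_IIA (S V : finType) (f : swf S V) :
  clerical_dictatorial f -> IIA f.
Proof.
have [n] := ubnP #|V|; elim: n => // n IH in S V f *; rewrite ltnS => Vn.
case=> [|S2|C fC hA]; [exact: null_IIA | exact: small_IIA |].
have rI (A : {set S}) : A \in eq_classes C -> IIA (restr A f).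
  move=> AC; have [_ [r rd]] := hA A AC.
  case: r => [|[[j dj]|A2]]; first exact: null_IIA.
    have [g [fg gCD]] := rd j dj; apply: (dictator_IIA dj fg).
    by apply: IH gCD; apply: leq_trans (card_drop_voter j) Vn.
  by apply: small_IIA; rewrite card_sig A2.
move=> P Q x y h.
have [Cxy|nCxy] := boolP (indiff C x y); last first.
  have [Cxy|nC] := boolP (wle C x y).
    have nC : ~~ wle C y x by move: nCxy; rewrite /indiff Cxy.
    have nf R : ~~ wle (f R) y x by apply: contra nC; apply: fC.
    by split; rewrite ?(negbTE (nf _)) ?(wleNW (nf _)).
  have nf R : ~~ wle (f R) x y by apply: contra nC; apply: fC.
  by split; rewrite ?(negbTE (nf _)) ?(wleNW (nf _)).
pose A := [set s in [set: S] | indiff C x s].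
have AC : A \in eq_classes C by apply/imsetP; exists x; rewrite ?inE.
have xA : x \in A by rewrite !inE /indiff wle_refl.
have yA : y \in A by rewrite !inE.
have [wd _] := hA A AC.
pose x' : {x | x \in A} := exist _ x xA; pose y' : {x | x \in A} := exist _ y yA.
have [] : agree_on (restr A f (sub_config A P)) (restr A f (sub_config A Q)) x' y'.
  apply: rI => // v; have [h1 h2] := h v.
  by rewrite /agree_on !ffunE !rel_prefE.
by rewrite /agree_on !restr_sub_config.
Qed.

Lemma null_CS (S V : finType) (f : swf S V) : null f -> CS f.
Proof.
move=> f0 x y; pose R : config S V := [ffun=> utility_pref (fun=> 0)].
by exists R, R; apply/andP; apply: f0.
Qed.

Lemma dictator_CS (S V : finType) (f : swf S V) (i : V) : dictator f i -> CS f.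
Proof.
move=> df.
suff ex x y : exists R, wle (f R) x y.
  by move=> x y; have [P hP] := ex x y; have [Q hQ] := ex y x; exists P, Q.
(* Everyone puts z alone on top: an ordinary dictator yields x <= y at [R y], a reversed one at
   [R x]. *)
pose R z : config S V := [ffun=> utility_pref (fun s => s == z : nat)].
have [<-|xy] := eqVneq x y; first by exists (R x); apply: wle_refl.
case: df => d; [exists (R y) | exists (R x)]; apply: wleNW.
  apply/negP=> /d; rewrite ffunE utility_prefE eqxx.
  by rewrite (negbTE xy).
apply/negP=> /d; rewrite ffunE utility_prefE eqxx eq_sym.
by rewrite (negbTE xy).
Qed.

Theorem theorem5 (S : finType) (hS : 3 <= #|S|) (N : nat) (f : swf S 'I_N) :
  (IIA f /\ CS f) <->
  (null f \/
   exists i : 'I_N, dictator f i /\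
     exists g : swf S {v : 'I_N | v != i},
       clerical_dictatorial g /\ defers f i g).
Proof.
split=> [[fI fC]|[f0|[i [di [g [gCD fg]]]]]].
- have [f0|[i di]] := wilson hS fI fC; first by left.
  right; exists i; split=> //; exists (deferred f (j := i)); split.
    by apply: IIA_clerical_dictatorial; apply: IIA_deferred.
  exact: defers_deferred.
- by split; [apply: null_IIA | apply: null_CS].
- split; last exact: dictator_CS di.
  by apply: dictator_IIA di fg _; apply: clerical_dictatorial_IIA.
Qed.
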